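(* Let $k\in\mathbb N_+$ and let $L$ be an infinite $k$-multiple context-free language over an alphabet $\Sigma$. Given $\mu\in\mathbb N_+$ there exist integers $M,m_1,\dots,m_M\in\mathbb N_+$, where $m_i\in[1,k]$, and sets $U_1,\dots,U_M$, where $U_i\subseteq(\Sigma^* )^{m_i}$ for $i\in[1,M]$, such that the following hold. (1) For each $i\in[1,M]$ and each $(u_1,\dots,u_{m_i})\in U_i$ there exists a word $w\in L$ with $U_i$-switchable factorisation $$w=w_0u_1w_1\cdots w_{m_i-1}u_{m_i}w_{m_i}.$$ (2) Given $\lambda\in\mathbb N_+$ there exists $N_\lambda\in\mathbb N_+$ such that $N_\lambda\ge\mu$ and, if $w\in L$ has at least $N_\lambda$ marked positions, then either (a) $w$ is $(\mu,N_\lambda)$-pumpable, or (b) there exists $i\in[1,M]$ such that $U_i$ is infinite and $w$ has a $U_i$-switchable factorisation $w=w_0u_1w_1\cdots w_{m_i-1}u_{m_i}w_{m_i}$ satisfying $$\sum_{j=0}^{m_i}|w_j|_\#\ge\lambda\quad\text{and}\quad\sum_{j=1}^{m_i}|u_j|_\#\ge\mu.$$ (3) There exists $N_\mu\in\mathbb N_+$ such that if $w\in L$ and $|w|_\#\ge N_\mu$ then either (a) $w$ is $(\mu,N_\mu)$-pumpable, or (b) there exists $i\in[1,M]$ such that $U_i$ is infinite and $w$ has a $U_i$-switchable factorisation $w=w_0u_1w_1\cdots w_{m_i-1}u_{m_i}w_{m_i}$ satisfying $$\mu\le\sum_{j=1}^{m_i}|u_j|_\#\le N_\mu.$$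
   Context: Notation: $\mathbb N_0=\{0,1,2,\dots\}$, $\mathbb N_+=\{1,2,\dots\}$; for integers $i\le j$, $[i,j]=\{i,i+1,\dots,j\}$. An alphabet is a finite set; $\Sigma^*$ is the set of all finite words over $\Sigma$, including the empty word $\varepsilon$; $|w|$ is the length of $w$. Multiple context-free languages. A multiple context-free grammar $G=(N,\Sigma,R,S)$ consists of a finite set $N$ of non-terminals, each with a rank in $\mathbb N_+$, an alphabet $\Sigma$ of terminals, a distinguished start non-terminal $S\in N$ of rank 1, and a finite set $R$ of rules, each of the form $$A(s_1,\dots,s_m)\leftarrow B_1(x^1_1,\dots,x^1_{k_1}),\dots,B_n(x^n_1,\dots,x^n_{k_n})\quad\text{or}\quad A(t_1,\dots,t_m)\leftarrow,$$ where $A\in N$ has rank $m$, $B_i\in N$ has rank $k_i$, the $x^i_j$ are pairwise distinct variables, $s_1,\dots,s_m$ are strings of terminals and variables $x^i_j$ such that each variable occurs at most once in the concatenation $s_1\cdots s_m$, and $t_1,\dots,t_m\in\Sigma^*$. Derivable facts are defined inductively: $A(t_1,\dots,t_m)$ is derivable for each rule of the second form; and for a rule of the first form, if $B_i(v^i_1,\dots,v^i_{k_i})$ is derivable for every $i\in[1,n]$ (with $v^i_j\in\Sigma^*$), then $A(s_1',\dots,s_m')$ is derivable, where $s_l'$ is obtained from $s_l$ by replacing each $x^i_j$ by $v^i_j$. The language of $G$ is $\{w\in\Sigma^*: S(w)\text{ is derivable}\}$. The grammar is $k$-multiple context-free if every non-terminal has rank at most $k$; a language is $k$-multiple context-free ($k$-MCF)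 if it is the language of some $k$-multiple context-free grammar. Marked letters. In a word $w$ any chosen subset of the letter positions may be declared marked; the number of marked positions is denoted $|w|_\#$. For a factor $v$ (occurring at a specified place) in a factorisation of $w$, $|v|_\#$ is the number of marked positions of $w$ lying in that factor. The statements about marked words hold for every choice of marking. Pumpable words. Let $L$ be a language over $\Sigma$ and $\alpha,\beta\in\mathbb N_+$ with $\alpha\le\beta$. A word $w\in L$ is $(\alpha,\beta)$-pumpable if there exist $x,y,z\in\Sigma^*$ with $|y|\in[\alpha,\beta]$ such that $w=xyz$ and $xy^nz\in L$ for all $n\in\mathbb N_0$. Switchable factorisations. Let $L$ be a language over $\Sigma$, $s\in\mathbb N_+$ and $U\subseteq(\Sigma^* )^s$. A $U$-factorisation of $w\in\Sigma^*$ is a factorisation $w=w_0u_1w_1\cdots u_sw_s$ (all factors in $\Sigma^*$) with $(u_1,\dots,u_s)\in U$. For $w\in L$, a $U$-factorisation $w=w_0u_1w_1\cdots u_sw_s$ is $U$-switchable if for all $(v_1,\dots,v_s)\in U$ the word $w_0v_1w_1\cdots v_sw_s$ belongs to $L$. *)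

(* Defs.v *)
From mathcomp Require Import all_boot.
From mathcomp Require Import classical_sets cardinality.

Set Implicit Arguments.
Unset Strict Implicit.
Unset Printing Implicit Defensive.

Section Rules.
Variables (Sigma N : finType) (rank : N -> nat).

(* The variable x^i_j of a rule with body B_1(...), ..., B_n(...) is the pair
   (i, j), so distinctness of the variables is built in. *)
Local Notation rule_var body := {i & 'I_(rank (tnth body i))}.

(* Both forms of rules are covered: with an empty body (rule_arity = 0) there
   are no variables, so that the strings consist of terminals only. *)
Record mcf_rule := MCFRule {
  rule_head : N;
  rule_arity : nat;
  rule_body : rule_arity.-tuple N;
  rule_strings : (rank rule_head).-tuple (seq (Sigma + rule_var rule_body));
  rule_linear : forall x : rule_var rule_body,
    count_mem (inr x) (flatten rule_strings) <= 1
}.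

Definition subst_vars (n : nat) (body : n.-tuple N)
    (v : forall i : 'I_n, (rank (tnth body i)).-tuple (seq Sigma))
    (s : seq (Sigma + rule_var body)) : seq Sigma :=
  flatten [seq match a with
               | inl c => [:: c]
               | inr x => tnth (v (tag x)) (tagged x)
               end | a <- s].

End Rules.

(* The finite set of rules is given as a family indexed by a finite type. *)
Record mcfg (Sigma : finType) := MCFG {
  nonterm : finType;
  rank : nonterm -> nat;
  rank_gt0 : forall A : nonterm, 0 < rank A;
  rule_index : finType;
  rule : rule_index -> mcf_rule Sigma rank;
  start : nonterm;
  rank_start : rank start = 1
}.

Inductive derivable (Sigma : finType) (G : mcfg Sigma) :
    nonterm G -> seq (seq Sigma) -> Prop :=
| Derive (r : rule_index G)
    (v : forall i : 'I_(rule_arity (rule r)),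
       (rank (tnth (rule_body (rule r)) i)).-tuple (seq Sigma)) :
    (forall i, derivable (tnth (rule_body (rule r)) i) (v i)) ->
    derivable (rule_head (rule r))
      [seq subst_vars v s | s <- rule_strings (rule r)].

Definition language (Sigma : finType) (G : mcfg Sigma) : set (seq Sigma) :=
  [set w | derivable (start G) [:: w]]%classic.

Definition is_mcf (k : nat) (Sigma : finType) (L : set (seq Sigma)) : Prop :=
  exists G : mcfg Sigma,
    (forall A : nonterm G, rank A <= k) /\ language G = L.

(* A marked word carries a boolean with each letter, [true] meaning that the
   position is marked; [unzip1] forgets the marking. *)
Definition marked_word (Sigma : finType) : Type := seq (Sigma * bool).

Definition nb_marked (Sigma : finType) (w : marked_word Sigma) : nat :=
  count snd w.

Definition pumpable (Sigma : finType) (L : set (seq Sigma))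
    (alpha beta : nat) (w : seq Sigma) : Prop :=
  exists x y z : seq Sigma,
    [/\ alpha <= size y <= beta,
        w = x ++ y ++ z
      & forall n : nat, L (x ++ flatten (nseq n y) ++ z)].

(* [interleave ws us] is w_0 u_1 w_1 ... u_s w_s. *)
Definition interleave (T : Type) (s : nat)
    (ws : s.+1.-tuple (seq T)) (us : s.-tuple (seq T)) : seq T :=
  thead ws ++ flatten [seq uw.1 ++ uw.2 | uw <- zip us (behead ws)].

Definition factorisation (Sigma : finType) (s : nat)
    (U : set (s.-tuple (seq Sigma))) (w : seq Sigma)
    (ws : s.+1.-tuple (seq Sigma)) (us : s.-tuple (seq Sigma)) : Prop :=
  w = interleave ws us /\ U us.

Definition switchable (Sigma : finType) (L : set (seq Sigma)) (s : nat)
    (U : set (s.-tuple (seq Sigma))) (w : seq Sigma)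
    (ws : s.+1.-tuple (seq Sigma)) (us : s.-tuple (seq Sigma)) : Prop :=
  factorisation U w ws us /\
  forall vs : s.-tuple (seq Sigma), U vs -> L (interleave ws vs).

(* A switchable factorisation of the word underlying [w], with the factors
   carrying the marking that they inherit from [w]. *)
Definition marked_switchable (Sigma : finType) (L : set (seq Sigma)) (s : nat)
    (U : set (s.-tuple (seq Sigma))) (w : marked_word Sigma)
    (ws : s.+1.-tuple (marked_word Sigma))
    (us : s.-tuple (marked_word Sigma)) : Prop :=
  w = interleave ws us /\
  switchable L U (unzip1 w)
    (map_tuple (@unzip1 Sigma bool) ws) (map_tuple (@unzip1 Sigma bool) us).

(* Main.v *)
Require Import Defs.
From mathcomp Require Import all_boot.
From mathcomp Require Import boolp classical_sets cardinality.

Set Implicit Arguments.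
Unset Strict Implicit.
Unset Printing Implicit Defensive.

(* Take U_(A,sigma) to be the set of tuples (v_sigma(1), ..., v_sigma(m)) for
   A(v) derivable, where sigma lists the components of A that survive in the
   derived word, in order of appearance: replacing a subderivation shows that
   every node of a derivation tree gives a switchable factorisation.  The marks
   below a node are shared, up to a constant, among its boundedly many children,
   so descending from the root into a child with many marks one reaches a node
   with still many marks below, but boundedly many (for (3)), or with at least
   lambda marks outside (for (2)).  More marks below a node than the total length
   of any tuple of a finite U_(A,sigma) force its U_(A,sigma) to be infinite.
   Thus (2)(b) and (3)(b) always hold, and pumping plays no role. *)

(** * Words with holes, their substitution and composition *)

Section Expand.
Variables T X S : Type.

(** The map [p] on letters is a parameter because letters are kept when holes are filled, erased
    when holes are listed, and stripped of their marks when a fact is replaced. *)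
Definition expand (p : T -> seq S) (f : X -> seq S) (s : seq (T + X)) : seq S :=
  flatten [seq match a with inl t => p t | inr x => f x end | a <- s].

Lemma expand_cons p f a s :
  expand p f (a :: s) = (match a with inl t => p t | inr x => f x end) ++ expand p f s.
Proof. by []. Qed.

Lemma expand_cat p f s1 s2 :
  expand p f (s1 ++ s2) = expand p f s1 ++ expand p f s2.
Proof. by rewrite /expand map_cat flatten_cat. Qed.

End Expand.

Definition single (T : Type) (t : T) : seq T := [:: t].

Definition holes (T X : Type) : seq (T + X) -> seq X :=
  expand (fun _ => [::]) (@single X).

Definition graft (T X Y : Type) : (X -> seq (T + Y)) -> seq (T + X) -> seq (T + Y) :=
  expand (fun t => [:: inl t]).

(** Associativity of substitution. With an erasing [p] it also computes the holes of a graft. *)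
Lemma expand_graft (T X Y S : Type) (p : T -> seq S) (f : Y -> seq S)
    (h : X -> seq (T + Y)) (s : seq (T + X)) :
  expand p f (graft h s) = expand p (fun x => expand p f (h x)) s.
Proof.
elim: s => // -[t|x] s IHs; rewrite [RHS]expand_cons -IHs -?expand_cat //.
Qed.

Lemma eq_expand (T S : Type) (X : eqType) (p : T -> seq S) (f g : X -> seq S)
    (s : seq (T + X)) :
  {in holes s, f =1 g} -> expand p f s = expand p g s.
Proof.
elim: s => // -[t|x] s IHs eq_fg; rewrite !expand_cons.
  by rewrite IHs // => x xs; apply: eq_fg.
rewrite eq_fg ?inE ?eqxx // IHs // => y ys; apply: eq_fg.
by rewrite inE [_ \in _]ys orbT.
Qed.

Lemma holes_expand (T X Y : Type) (p : T -> seq Y) (f : X -> seq Y) (s : seq (T + X)) :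
  (forall t, p t = [::]) -> expand p f s = flatten [seq f x | x <- holes s].
Proof.
move=> p0; elim: s => // -[t|x] s IHs; rewrite expand_cons IHs ?p0 //.
Qed.

Lemma count_holes (T X : eqType) (x : X) (s : seq (T + X)) :
  count_mem x (holes s) = count_mem (inr x) s.
Proof. by elim: s => // -[t|y] s IHs; rewrite /holes expand_cons count_cat IHs /= ?addn0. Qed.

(** * Transporting the marking of a word to the strings that produce it *)

Section Marks.
Variable Sigma : finType.
Notation mword := (marked_word Sigma).

Lemma nb_marked_cat (u v : mword) : nb_marked (u ++ v) = nb_marked u + nb_marked v.
Proof. exact: count_cat. Qed.

Definition forget (X : Type) (a : Sigma * bool + X) : Sigma + X :=
  match a with inl t => inl t.1 | inr x => inr x end.

Lemma expand_forget (X S : Type) (p : Sigma -> seq S) (f : X -> seq S)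
    (s : seq (Sigma * bool + X)) :
  expand p f (map (@forget X) s) = expand (p \o fst) f s.
Proof. by rewrite /expand -map_comp; congr flatten; apply: eq_map => -[]. Qed.

Lemma holes_forget (X : Type) (s : seq (Sigma * bool + X)) :
  holes (map (@forget X) s) = holes s.
Proof. exact: expand_forget. Qed.

Lemma unzip1_expand (X : Type) (f : X -> mword) (s : seq (Sigma * bool + X)) :
  unzip1 (expand (@single _) f s)
  = expand (@single _ \o fst) (fun x => unzip1 (f x)) s.
Proof.
rewrite /unzip1 /expand map_flatten -map_comp.
by congr flatten; apply: eq_map => -[].
Qed.

(** Reading [s] from left to right, each hole [x] cuts a piece of length [size (f x)] off [w]; as no
    hole recurs, the pieces define a function. Prescribing [g] away from the holes allows several
    strings to be treated in turn. *)
Lemma lift_marks (X : eqType) (f : X -> seq Sigma) (g : X -> mword)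
    (s : seq (Sigma + X)) (w : mword) :
  (forall x, unzip1 (g x) = f x) -> uniq (holes s) ->
  unzip1 w = expand (@single _) f s ->
  exists s' f', [/\ map (@forget X) s' = s, w = expand (@single _) f' s',
    forall x, unzip1 (f' x) = f x & forall x, x \notin holes s -> f' x = g x].
Proof.
move=> gf; elim: s w => [|[t|x] s IHs] w.
- by case: w => // _ _; exists [::], g.
- case: w => // -[t' b] w /= us [-> e].
  have [s' [f' [<- -> f'f f'g]]] := IHs w us e.
  by exists (inl (t, b) :: s'), f'.
- rewrite /holes !expand_cons cat_uniq /= => /andP [xs us] e.
  have xNs : x \notin holes s.
    by apply: contra xs => xs; apply/hasP; exists x; rewrite ?inE.
  have e1 : unzip1 (take (size (f x)) w) = f x by rewrite /unzip1 map_take -/(unzip1 w) e take_size_cat.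
  have e2 : unzip1 (drop (size (f x)) w) = expand (@single _) f s.
    by rewrite /unzip1 map_drop -/(unzip1 w) e drop_size_cat.
  have [s' [f' [es ew f'f f'g]]] := IHs _ us e2.
  exists (inr x :: s'), (fun y => if y == x then take (size (f x)) w else f' y).
  split.
  + by rewrite /= es.
  + rewrite expand_cons eqxx -{1}(cat_take_drop (size (f x)) w) ew; congr (_ ++ _).
    apply: eq_expand => y; rewrite -holes_forget es.
    by case: eqP => // ->; rewrite (negPf xNs).
  + by move=> y; case: eqP => [->|].
  + by move=> y; rewrite inE negb_or => /andP [/negPf -> /f'g].
Qed.

Lemma lift_marks_seq (X : eqType) (f : X -> seq Sigma)
    (ss : seq (seq (Sigma + X))) (ws : seq mword) :
  uniq (flatten (map (@holes _ _) ss)) ->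
  map (@unzip1 _ _) ws = map (expand (@single _) f) ss ->
  exists ss' f', [/\ map (map (@forget X)) ss' = ss,
    ws = map (expand (@single _) f') ss' & forall x, unzip1 (f' x) = f x].
Proof.
elim: ss ws => [|s ss IHss] [|w ws] //=.
  move=> _ _; exists [::], (fun x => [seq (t, false) | t <- f x]); split=> // x.
  by rewrite /unzip1 -map_comp map_id.
rewrite cat_uniq => /and3P [us /hasPn dis uss] [ew ews].
have [ss' [g [ess -> gf]]] := IHss ws uss ews.
(* The holes of the other strings are disjoint from those of [s], so there [f'] still agrees with
   [g]. *)
have [s' [f' [es -> f'f f'g]]] := lift_marks gf us ew.
exists (s' :: ss'), f'; split=> //=; first by rewrite es ess.
congr (_ :: _); apply/eq_in_map => t tss'; apply: eq_expand => x xt.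
rewrite f'g //; apply: dis; apply/flatten_mapP; exists (map (@forget X) t).
  by rewrite -ess map_f.
by rewrite holes_forget.
Qed.

Definition outer_marks (X : Type) : seq (Sigma * bool + X) -> nat :=
  count (fun a => if a is inl t then t.2 else false).

Definition inner_marks (X : Type) (f : X -> mword) (s : seq (Sigma * bool + X)) :=
  \sum_(x <- holes s) nb_marked (f x).

Lemma nb_marked_expand (X : Type) (f : X -> mword) s :
  nb_marked (expand (@single _) f s) = outer_marks s + inner_marks f s.
Proof.
rewrite /inner_marks; elim: s => [|[t|x] s IHs]; first by rewrite big_nil.
  by rewrite expand_cons nb_marked_cat IHs /= /nb_marked /= addn0 addnA.
rewrite expand_cons nb_marked_cat IHs /holes expand_cons /single /= big_cons.
by rewrite add0n addnCA.
Qed.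

End Marks.

(** * Multiplicities in selected parts of a list *)

Lemma count_le1_uniq (X : eqType) (s : seq X) :
  (forall x, count_mem x s <= 1) -> uniq s.
Proof.
move=> count_s; apply: count_mem_uniq => x; have := count_s x.
by rewrite -has_pred1 has_count; case: (count _ _) => [|[]].
Qed.

Lemma leq_sum_nth (T : Type) (x0 : T) (F : T -> nat) (ts : seq T) (js : seq nat) :
  uniq js -> {in js, forall j, j < size ts} ->
  \sum_(j <- js) F (nth x0 ts j) <= \sum_(t <- ts) F t.
Proof.
move=> ujs js_lt; rewrite (big_nth x0).
apply: (uniq_sub_le_big leqnn (fun x y => leq_addr y x)) => //; first exact: iota_uniq.
by move=> j /js_lt; rewrite mem_index_iota.
Qed.

(** Multiplicities can only drop when components are omitted or permuted; this carries the linearity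
    of a rule over to contexts. *)
Lemma uniq_flatten_nth (X : eqType) (ts : seq (seq X)) (js : seq nat) :
  uniq js -> {in js, forall j, j < size ts} -> uniq (flatten ts) ->
  uniq (flatten [seq nth [::] ts j | j <- js]).
Proof.
move=> ujs js_lt uts; apply: count_le1_uniq => x.
apply: (leq_trans _ (leq_b1 (x \in flatten ts))).
rewrite -count_uniq_mem // !count_flatten !sumnE !big_map.
exact: leq_sum_nth.
Qed.

(** * Contexts of a node in a derivation tree, and passage to its children *)

Section Contexts.
Variables (Sigma : finType) (G : mcfg Sigma).
Notation mword := (marked_word Sigma).

(* A one-node context: the letters of [c] are the part of [w] outside the node,
   and the hole [j] stands for the component [j] of the fact [A(vm)] derived
   at the node.  The last clause makes the node replaceable. *)
Definition occurs (w : mword) (A : nonterm G) (c : seq (Sigma * bool + nat))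
    (vm : seq mword) : Prop :=
  [/\ w = expand (@single _) (nth [::] vm) c,
      uniq (holes c),
      {in holes c, forall j, j < rank A}
    & forall v, derivable A v ->
        language G (expand (@single _ \o fst) (nth [::] v) c)].

Lemma size_derivable (A : nonterm G) (v : seq (seq Sigma)) : derivable A v -> size v = rank A.
Proof. by case=> r {}v _; rewrite size_map size_tuple. Qed.

(** The rule splits the components at the node into its own letters and words of the children; for
    one child, all the rest is context. Only marks on the rule's own letters belong to no child. *)
Lemma occurs_children (w : mword) (r : rule_index G)
    (v : forall i : 'I_(rule_arity (rule r)),
       (rank (tnth (rule_body (rule r)) i)).-tuple (seq Sigma))
    (vm : seq mword) (c : seq (Sigma * bool + nat)) :
  (forall i, derivable (tnth (rule_body (rule r)) i) (v i)) ->
  map (@unzip1 _ _) vm = [seq subst_vars v s | s <- rule_strings (rule r)] ->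
  occurs w (rule_head (rule r)) c vm ->
  exists cs vms,
    (forall i, map (@unzip1 _ _) (vms i) = v i /\
       occurs w (tnth (rule_body (rule r)) i) (cs i) (vms i)) /\
    inner_marks (nth [::] vm) c <=
      size (flatten (rule_strings (rule r)))
      + \sum_i inner_marks (nth [::] (vms i)) (cs i).
Proof.
set strs := rule_strings (rule r) => der_v e_vm [ew uc c_lt c_good].
have uniq_strs : uniq (flatten (map (@holes _ _) strs)).
  apply: count_le1_uniq => x.
  rewrite count_flatten -map_comp (eq_map (count_holes x)) -count_flatten.
  exact: rule_linear.
have [ss [f [e_ss e_vm' f_v]]] :=
  lift_marks_seq (f := fun x => tnth (v (tag x)) (tagged x)) uniq_strs e_vm.
have size_ss : size ss = rank (rule_head (rule r)).
  by rewrite -(size_map (map (@forget _ _))) e_ss size_tuple.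
have c_ss : {in holes c, forall j, j < size ss} by move=> j /c_lt; rewrite size_ss.
have holes_ss : map (@holes _ _) ss = map (@holes _ _) strs.
  by rewrite -e_ss -map_comp; apply: eq_map => s /=; rewrite holes_forget.
(* The holes of [e] are the variables of the rule that survive in [w], over all children at once. *)
pose e := graft (nth [::] ss) c.
have holes_e : holes e = flatten [seq holes (nth [::] ss j) | j <- holes c].
  by rewrite /e /holes expand_graft -/(holes c) [LHS]holes_expand.
have ue : uniq (holes e).
  rewrite holes_e.
  have -> : [seq holes (nth [::] ss j) | j <- holes c] =
            [seq nth [::] (map (@holes _ _) ss) j | j <- holes c].
    by apply/eq_in_map => j /c_ss jlt; rewrite (nth_map [::]).
  by apply: uniq_flatten_nth; rewrite ?holes_ss // -holes_ss size_map.
pose vms i := [seq f (Tagged _ j) | j <- enum 'I_(rank (tnth (rule_body (rule r)) i))].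
(* In the context of child [i], the words of its siblings become letters. *)
pose cs i := graft (fun x => if tag x == i then [:: inr (nat_of_ord (tagged x))]
                             else map inl (f x)) e.
have vms_nth i (j : 'I_(rank (tnth (rule_body (rule r)) i))) :
    nth [::] (vms i) (nat_of_ord j) = f (Tagged _ j).
  by rewrite (nth_map j) ?nth_ord_enum // size_enum_ord.
have holes_cs i : holes (cs i) = [seq nat_of_ord (tagged x) | x <- holes e & tag x == i].
  rewrite /cs /holes expand_graft -/(holes e) [LHS]holes_expand //.
  elim: (holes e) => //= x s ->; case: ifP => // _.
  by rewrite /expand -map_comp; elim: (f x).
have inner_cs i : inner_marks (nth [::] (vms i)) (cs i)
                  = \sum_(x <- holes e | tag x == i) nb_marked (f x).
  rewrite /inner_marks holes_cs big_map big_filter; apply: eq_bigr => -[i' j] /=.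
  by move=> /eqP e_i; case: _ / e_i; rewrite vms_nth.
exists cs, vms; split; last first.
  have -> : \sum_i inner_marks (nth [::] (vms i)) (cs i)
            = \sum_(x <- holes e) nb_marked (f x).
    rewrite (partition_big (fun x => tag x) xpredT) //.
    by apply: eq_bigr => i _; apply: inner_cs.
  rewrite holes_e big_flatten big_map -/(holes c).
  apply: (@leq_trans (\sum_(j <- holes c) (size (nth [::] ss j)
            + \sum_(x <- holes (nth [::] ss j)) nb_marked (f x)))).
    rewrite /inner_marks big_seq [leqRHS]big_seq; apply: leq_sum => j /c_ss jlt.
    rewrite e_vm' (nth_map [::]) // nb_marked_expand leq_add2r; exact: count_size.
  rewrite big_split leq_add2r /= size_flatten sumnE big_map.
  rewrite -[X in _ <= \sum_(_ <- X) _]e_ss big_map.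
  under [leqRHS]eq_bigr do rewrite size_map.
  exact: leq_sum_nth.
move=> i; split.
  have size_vms : size (vms i) = rank (tnth (rule_body (rule r)) i).
    by rewrite /vms size_map size_enum_ord.
  apply: (@eq_from_nth _ [::]); rewrite size_map size_vms ?size_tuple // => j jlt.
  rewrite (nth_map [::]) ?size_vms // (vms_nth i (Ordinal jlt)) f_v /=.
  by rewrite (tnth_nth [::]).
split.
- rewrite ew /cs /e !expand_graft; apply: eq_expand => j /c_ss jlt.
  rewrite e_vm' (nth_map [::]) //; apply: eq_expand => -[i' j'] _ /=.
  case: eqP => [e_i|_]; last by elim: (f _) => //= a s {1}->.
  by case: _ / e_i; rewrite expand_cons /= vms_nth cats0.
- rewrite holes_cs map_inj_in_uniq ?filter_uniq // => -[i1 j1] [i2 j2].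
  rewrite !mem_filter /= => /andP [/eqP e1 _] /andP [/eqP e2 _].
  by case: _ / (esym e1) j1 => j1; case: _ / (esym e2) j2 => j2 /ord_inj ->.
- move=> j; rewrite holes_cs => /mapP [[i' j'] ]; rewrite mem_filter /=.
  by case/andP => /eqP <- _ ->.
move=> u der_u.
have su : size u == rank (tnth (rule_body (rule r)) i) by rewrite (size_derivable der_u).
(* The rule is applied again with [u] for child [i] and the old facts for its siblings, so
   replaceability passes from the node to the child. *)
pose v' := dfwith v (Tuple su).
have der_v' i' : derivable (tnth (rule_body (rule r)) i') (v' i').
  by rewrite /v'; case: dfwithP.
have := c_good _ (Derive der_v'); congr (language G _).
rewrite /cs /e !expand_graft; apply: eq_expand => j /c_ss jlt.
rewrite -/strs -e_ss (nth_map [::]) ?size_map // (nth_map [::]) //.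
rewrite [LHS]expand_forget; apply: eq_expand => -[i' j'] _ /=.
rewrite /v' /=; case: dfwithP j' => [|i'' ne] j'.
  by rewrite eqxx expand_cons /= cats0 (tnth_nth [::]).
rewrite eq_sym (negPf ne); apply: etrans (esym (f_v (existT _ i'' j'))) _.
by elim: (f _) => //= a s ->.
Qed.

End Contexts.

(** * Descent from the root to a node with suitably many marks *)

Section Descent.
Variables (Sigma : finType) (G : mcfg Sigma).
Notation mword := (marked_word Sigma).

(* [stop] is a stopping condition on the number of marks below a node; a node
   violating it has so many marks that one of its children has at least [d]. *)
Lemma descend (w : mword) (b n d : nat) (stop : pred nat) :
  (forall r : rule_index G, size (flatten (rule_strings (rule r))) <= b) ->
  (forall r : rule_index G, rule_arity (rule r) <= n) ->
  (forall x, ~~ stop x -> b + n * d < x) ->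
  forall (A : nonterm G) v vm c, derivable A v -> map (@unzip1 _ _) vm = v ->
  occurs w A c vm -> d <= inner_marks (nth [::] vm) c ->
  exists (A' : nonterm G) vm' c',
    [/\ derivable A' (map (@unzip1 _ _) vm'), occurs w A' c' vm',
        d <= inner_marks (nth [::] vm') c' & stop (inner_marks (nth [::] vm') c')].
Proof.
move=> le_b le_n stopP A v vm c der; elim: der vm c => r {}v der IH vm c e_vm occ d_le.
case: (boolP (stop (inner_marks (nth [::] vm) c))) => [st|/stopP big].
  by exists (rule_head (rule r)), vm, c; split=> //; rewrite e_vm; apply: Derive.
have [cs [vms [children le_sum]]] := occurs_children der e_vm occ.
case: (boolP [exists i, d <= inner_marks (nth [::] (vms i)) (cs i)]).
  by case/existsP => i; have [e_i occ_i] := children i; apply: (IH i).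
rewrite negb_exists => /forallP small; have := leq_trans big le_sum.
rewrite ltnNge leq_add // (leq_trans (n := \sum_(i < rule_arity (rule r)) d)) //.
  by apply: leq_sum => i _; apply: ltnW; rewrite ltnNge.
by rewrite sum_nat_const card_ord leq_mul2r le_n orbT.
Qed.

Lemma occurs_root (w : mword) : occurs w (start G) [:: inr 0] [:: w].
Proof.
split=> //; first by rewrite expand_cons /= cats0.
  by move=> j; rewrite inE => /eqP ->; rewrite rank_start.
move=> v der; have := size_derivable der; rewrite rank_start.
by case: v der => [|x [|//]] // der _; rewrite expand_cons /= cats0.
Qed.

End Descent.

(** * From contexts to interleaved factorisations *)

Section Weave.

(** [interleave] without lengths in the types, so that segments can be built by recursion on a
    context. *)
Definition weave (T : Type) (ws us : seq (seq T)) : seq T :=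
  head [::] ws ++ flatten [seq uw.1 ++ uw.2 | uw <- zip us (behead ws)].

Lemma interleaveE (T : Type) s (ws : s.+1.-tuple (seq T)) (us : s.-tuple (seq T)) :
  interleave ws us = weave ws us.
Proof. by rewrite /interleave /weave /thead (tnth_nth [::]) nth0. Qed.

(** The segments are the possibly empty runs of letters between consecutive holes. They do not
    depend on the filling [f], which is what makes factorisations switchable. *)
Lemma weave_segments (Sigma : finType) (X : Type) (c : seq (Sigma * bool + X)) :
  exists ws : seq (marked_word Sigma), [/\ size ws = (size (holes c)).+1,
    forall f, expand (@single _) f c = weave ws (map f (holes c))
  & forall f, expand (@single _ \o fst) f c
              = weave (map (@unzip1 _ _) ws) (map f (holes c))].
Proof.
elim: c => [|[t|x] c [[|w ws] [//= sz m u]]].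
- by exists [:: [::]].
- exists ((t :: w) :: ws); split=> // f.
    by rewrite expand_cons m.
  by rewrite expand_cons u.
- exists [:: [::], w & ws]; split=> [|f|f]; first by rewrite /= sz.
    by rewrite expand_cons m /weave /= !catA.
  by rewrite expand_cons u /weave /= !catA.
Qed.

Lemma nb_marked_interleave (Sigma : finType) s (ws : s.+1.-tuple (marked_word Sigma))
    (us : s.-tuple (marked_word Sigma)) :
  nb_marked (interleave ws us)
  = \sum_(j < s.+1) nb_marked (tnth ws j) + \sum_(j < s) nb_marked (tnth us j).
Proof.
rewrite interleaveE -(big_tuple _ _ ws xpredT (@nb_marked _)).
rewrite -(big_tuple _ _ us xpredT (@nb_marked _)).
case: ws us => -[|w ws] //= sz [us /= /eqP sz_us]; have: size ws = size us.
  by move: sz; rewrite eqSS sz_us => /eqP.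
rewrite /weave /= big_cons nb_marked_cat -addnA => {sz sz_us} e_sz; congr (_ + _).
elim: ws us e_sz => [|x ws IH] [|u us] //= => [_|[/IH e]]; first by rewrite !big_nil.
by rewrite !big_cons !nb_marked_cat e (addnC (nb_marked u)) addnACA.
Qed.

End Weave.

(** * The finitely many candidates for the sets U_i *)

Section Sites.
Variables (Sigma : finType) (G : mcfg Sigma) (k : nat).
Hypothesis rank_le : forall A : nonterm G, rank A <= k.

(* A non-terminal with the list of its components, in order of appearance,
   that survive in the whole word; the others may be dropped or permuted. *)
Definition site : finType := (nonterm G * {m : 'I_k & m.+1.-tuple 'I_k})%type.

Definition arity (i : site) : nat := (tag i.2).+1.

Definition select (T : Type) (i : site) (v : seq (seq T)) : (arity i).-tuple (seq T) :=
  map_tuple (fun j : 'I_k => nth [::] v j) (tagged i.2).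

(* Empty unless the site does occur in some context. *)
Definition fillers (i : site) : set ((arity i).-tuple (seq Sigma)) :=
  [set us | (exists ws : (arity i).+1.-tuple (seq Sigma),
               forall v, derivable i.1 v -> language G (interleave ws (select i v)))
            /\ exists2 v, derivable i.1 v & us = select i v]%classic.
Arguments fillers i _ : clear implicits.

Lemma fillers_switchable (i : site) (us : (arity i).-tuple (seq Sigma)) :
  fillers i us ->
  exists w ws, language G w /\ switchable (language G) (fillers i) w ws us.
Proof.
move=> Uus; have [[ws good] [v der e]] := Uus.
exists (interleave ws us), ws; split; first by rewrite e; apply: good.
by split=> // _ [_ [v' der' ->]]; apply: good.
Qed.

(** The site is [A] with the list of holes of [c]. The holes are distinct and below [rank A], hence
    at most [k] in number; a mark below the node forces at least one. *)
Lemma occurs_switchable (w : marked_word Sigma) (A : nonterm G) c vm :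
  derivable A (map (@unzip1 _ _) vm) -> occurs w A c vm ->
  0 < inner_marks (nth [::] vm) c ->
  exists (i : site) ws us, marked_switchable (language G) (fillers i) w ws us /\
    \sum_(j < arity i) nb_marked (tnth us j) = inner_marks (nth [::] vm) c.
Proof.
move=> der [ew uc c_lt good] marks_gt0.
have [ws [sz_ws mE uE]] := weave_segments c.
have size_vm : size vm = rank A by rewrite -(size_derivable der) size_map.
have c_ltk : all (fun j => j < k) (holes c).
  by apply/allP => j /c_lt jlt; apply: leq_trans (rank_le A).
have hc_gt0 : 0 < size (holes c).
  by move: marks_gt0; rewrite /inner_marks; case: (holes c); rewrite ?big_nil.
have hc_lek : size (holes c) <= k.
  rewrite -(size_iota 0 k); apply: uniq_leq_size => // j /(allP c_ltk).
  by rewrite mem_iota.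
have hc_lt : (size (holes c)).-1 < k by rewrite prednK.
(* All holes are below [k], so [insub] discards none of them. *)
have sig_sz : size (pmap insub (holes c) : seq 'I_k) == (Ordinal hc_lt).+1.
  by rewrite size_pmap_sub prednK // -all_count.
pose i : site := (A, existT _ (Ordinal hc_lt) (Tuple sig_sz)).
have e_sig : map val (pmap insub (holes c) : seq 'I_k) = holes c.
  rewrite (pmap_filter (insubK _)) (eq_filter (isSome_insub _)).
  exact/all_filterP.
have selE T (v : seq (seq T)) : select i v = [seq nth [::] v j | j <- holes c] :> seq _.
  rewrite /= -[in RHS]e_sig -map_comp; exact: eq_map.
have sz_ws' : size ws == (arity i).+1 by rewrite sz_ws /arity /= prednK.
have wE : w = interleave (Tuple sz_ws') (select i vm).
  by rewrite interleaveE /= ew mE selE.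
have unE v : interleave (map_tuple (@unzip1 _ _) (Tuple sz_ws')) (select i v)
             = expand (@single _ \o fst) (nth [::] v) c.
  by rewrite interleaveE uE selE.
have sel_unzip : map_tuple (@unzip1 _ _) (select i vm) = select i (map (@unzip1 _ _) vm).
  apply: val_inj; rewrite [RHS]selE.
  transitivity (map (@unzip1 _ _) (select i vm)) => //.
  rewrite selE -map_comp; apply/eq_in_map => j /c_lt jlt /=.
  by rewrite (nth_map [::]) ?size_vm.
have fills v : derivable A v -> fillers i (select i v).
  move=> der_v; split; last by exists v.
  by exists (map_tuple (@unzip1 _ _) (Tuple sz_ws')) => v' /good; rewrite unE.
exists i, (Tuple sz_ws'), (select i vm); split.
  split=> //; rewrite /switchable sel_unzip; split.
    split; last exact: fills.
    rewrite unE ew unzip1_expand; apply: eq_expand => j /c_lt jlt.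
    by rewrite (nth_map [::]) ?size_vm.
  by move=> _ [_ [v' der' ->]]; rewrite unE; apply: good.
by rewrite -(big_tuple _ _ (select i vm) xpredT (@nb_marked _)) selE big_map.
Qed.

(** There are finitely many sites, so bounds for the single sites add up to a common one; for an
    infinite set the claim is vacuous and 0 serves. *)
Lemma fillers_bounded :
  exists C, forall i us, finite_set (fillers i) -> fillers i us ->
    \sum_(j < arity i) size (tnth us j) <= C.
Proof.
have bound i : exists C, forall us, finite_set (fillers i) -> fillers i us ->
    \sum_(j < arity i) size (tnth us j) <= C.
  case: (pselect (finite_set (fillers i))) => [|inf]; last by exists 0 => us /inf.
  case/finite_seqP => s es.
  exists (\sum_(us <- s) \sum_(j < arity i) size (tnth us j)) => us _.
  rewrite es /= => us_s; rewrite (big_rem us us_s); exact: leq_addr.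
have [C CP] := choice bound.
exists (\sum_i C i) => i us fin Uus; apply: (leq_trans (CP i us fin Uus)).
by rewrite (bigD1 i) //=; apply: leq_addr.
Qed.

End Sites.
Arguments fillers {Sigma G k} i _.

(** * Constants and stopping conditions for the two descents *)

Theorem theorem4p5 (k : nat) (Sigma : finType) (L : set (seq Sigma))
    (mu : nat) :
  0 < k -> is_mcf k L -> infinite_set L -> 0 < mu ->
  exists (M : nat) (m : 'I_M -> nat)
         (U : forall i : 'I_M, set ((m i).-tuple (seq Sigma))),
    0 < M /\ (forall i : 'I_M, 1 <= m i <= k) /\
    (forall (i : 'I_M) (us : (m i).-tuple (seq Sigma)), U i us ->
       exists (w : seq Sigma) (ws : (m i).+1.-tuple (seq Sigma)),
         L w /\ switchable L (U i) w ws us) /\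
    (forall lambda : nat, 0 < lambda ->
       exists N : nat, 0 < N /\ mu <= N /\
         forall w : marked_word Sigma, L (unzip1 w) -> N <= nb_marked w ->
           pumpable L mu N (unzip1 w) \/
           exists i : 'I_M, infinite_set (U i) /\
             exists (ws : (m i).+1.-tuple (marked_word Sigma))
                    (us : (m i).-tuple (marked_word Sigma)),
               marked_switchable L (U i) w ws us /\
               lambda <= \sum_(j < (m i).+1) nb_marked (tnth ws j) /\
               mu <= \sum_(j < m i) nb_marked (tnth us j)) /\
    (exists N : nat, 0 < N /\
       forall w : marked_word Sigma, L (unzip1 w) -> N <= nb_marked w ->
         pumpable L mu N (unzip1 w) \/
         exists i : 'I_M, infinite_set (U i) /\
           exists (ws : (m i).+1.-tuple (marked_word Sigma))
                  (us : (m i).-tuple (marked_word Sigma)),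
             marked_switchable L (U i) w ws us /\
             mu <= \sum_(j < m i) nb_marked (tnth us j) <= N).
Proof.
move=> k_gt0 [G [rank_le <-]] _ mu_gt0.
have [C CP] := fillers_bounded G k.
(* Of the [d] marks kept below the node, [mu] are demanded by the conclusion, and having more than
   [C] excludes a finite set of fillers. *)
pose d := mu + C.+1.
pose b := \sum_r size (flatten (rule_strings (@rule _ G r))).
pose n := \sum_r rule_arity (@rule _ G r).
have le_b r : size (flatten (rule_strings (@rule _ G r))) <= b.
  by rewrite /b (bigD1 r) //= leq_addr.
have le_n r : rule_arity (@rule _ G r) <= n by rewrite /n (bigD1 r) //= leq_addr.
(* Common core of (2) and (3), which differ only in [stop]. *)
have split_at (w : marked_word Sigma) (stop : pred nat) :
    language G (unzip1 w) -> d <= nb_marked w ->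
    (forall x, ~~ stop x -> b + n * d < x) ->
    exists i : 'I_#|site G k|, infinite_set (fillers (enum_val i)) /\
      exists ws us, [/\ marked_switchable (language G) (fillers (enum_val i)) w ws us,
        mu <= \sum_(j < arity (enum_val i)) nb_marked (tnth us j)
      & stop (\sum_(j < arity (enum_val i)) nb_marked (tnth us j))].
  move=> Lw dw stopP.
  have root_marks : inner_marks (nth [::] [:: w]) [:: inr 0] = nb_marked w.
    by rewrite /inner_marks /holes expand_cons /= big_cons big_nil addn0.
  have [|A [vm [c [der occ d_le st]]]] :=
    descend le_b le_n stopP (vm := [:: w]) Lw erefl (occurs_root G w).
    by rewrite root_marks.
  have marks_gt0 := leq_trans mu_gt0 (leq_trans (leq_addr _ _) d_le).
  have [i [ws [us [sw e]]]] := occurs_switchable rank_le der occ marks_gt0.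
  have [i' e_i] : exists i' : 'I_#|site G k|, i = enum_val i'.
    by exists (enum_rank i); rewrite enum_rankK.
  subst i; exists i'; split; last first.
    by exists ws, us; rewrite e; split=> //; apply: leq_trans d_le; apply: leq_addr.
  (* The marks in [us] number at least [d], and its total length is no smaller, hence exceeds
     [C]. *)
  move=> /CP fin; have [_ [[_ Uus] _]] := sw; have := fin _ Uus.
  apply/negP; rewrite -ltnNge; apply: (@leq_trans d); first by rewrite leq_addl.
  apply: (leq_trans d_le); rewrite -e; apply: leq_sum => j _.
  by rewrite tnth_map size_map; apply: count_size.
exists #|site G k|, (fun i => arity (enum_val i)), (fun i => fillers (enum_val i)).
split.
  apply/card_gt0P; exists (start G, existT _ (Ordinal k_gt0) [tuple Ordinal k_gt0]).
  by [].
split; first by move=> i; rewrite /arity ltn_ord.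
split; first by move=> i us; apply: fillers_switchable.
split.
  (* The descent stops once [lambda] marks lie outside the node. Before that, all but fewer than
     [lambda] marks lie below, hence more than [b + n * d]; the summand [d] lets the descent start
     at the root. *)
  move=> lambda lambda_gt0; exists (lambda + (b + n * d) + d).
  split; first by rewrite -addnA addn_gt0 lambda_gt0.
  split; first by rewrite (leq_trans _ (leq_addl _ _)) ?leq_addr.
  move=> w Lw Nw; right.
  have [||i [inf [ws [us [sw mu_le st]]]]] :=
    split_at w (fun x => lambda + x <= nb_marked w) Lw.
  - exact: leq_trans (leq_addl _ _) Nw.
  - move=> x; rewrite -ltnNge => lt_x; rewrite -(ltn_add2l lambda).
    by apply: leq_trans lt_x; rewrite ltnS (leq_trans (leq_addr _ _) Nw).
  exists i; split=> //; exists ws, us; split=> //; split=> //.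
  by move: st; have [-> _] := sw; rewrite nb_marked_interleave leq_add2r.
(* Here the descent stops as soon as the marks below the node are within the bound itself. *)
exists (b + n * d + d); split; first by rewrite /d !addnS.
move=> w Lw Nw; right.
have [||i [inf [ws [us [sw mu_le st]]]]] :=
  split_at w (fun x => x <= b + n * d + d) Lw.
- exact: leq_trans (leq_addl _ _) Nw.
- by move=> x; rewrite -ltnNge; apply: leq_trans; rewrite ltnS leq_addr.
by exists i; split=> //; exists ws, us; split=> //; rewrite mu_le.
Qed.
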